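(* Let $(X,\operatorname{dist})$ be a metric space and let $W_1(X)$ be its $1$-Wasserstein space, with $X$ regarded as a subset of $W_1(X)$ via the isometric embedding $x\mapsto\delta_x$. Then for every accumulation point $x\in X$, $\operatorname{reach}(x, X\subset W_1(X)) = 0$. In particular, if $X$ is not discrete, then $\operatorname{reach}(X\subset W_1(X)) = 0$.
   Context: Wasserstein space: for $p\ge 1$, $\mathcal P_p(X)$ is the set of probability measures $\mu$ on $X$ with $\int_X \operatorname{dist}(x,x_0)^p\,d\mu(x)<\infty$ for some $x_0\in X$. $\Gamma(\mu,\nu)$ is the set of transference plans, i.e. probability measures $\pi$ on $X\times X$ with marginals $\mu$ and $\nu$. $W_p(\mu,\nu)=\left(\inf_{\pi\in\Gamma(\mu,\nu)}\int_{X\times X}\operatorname{dist}(x,y)^p\,d\pi(x,y)\right)^{1/p}$, and $W_p(X)$ denotes the metric space $(\mathcal P_p(X),W_p)$. The map $x\mapsto\delta_x$ (Dirac mass) is an isometric embedding $X\hookrightarrow W_p(X)$, and $X$ is identified with its image. Reach: for a metric space $(Y,d)$ and a subset $A\subset Y$, let $\operatorname{Unp}(A)=\{y\in Y:\text{there exists a unique } a\in A \text{ with } d(y,A)=d(y,a)\}$. For $a\in A$, $\operatorname{reach}(a,A\subset Y)=\sup\{r\ge 0: B_r(a)\subset\operatorname{Unp}(A)\}$, where $B_r(a)$ is the open ball in $Y$, and $\operatorname{reach}(A\subset Y)=\inf_{a\in A}\operatorname{reach}(a,A\subset Y)$. ''Not discrete'' means that $X$ has an accumulation point. *)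

(* Defs.v *)
From HB Require Import structures.
From mathcomp Require Import all_boot all_order all_algebra.
From mathcomp Require Import all_classical all_reals all_analysis.
From mathcomp Require Import measurable_realfun exp.

Set Implicit Arguments.
Unset Strict Implicit.
Unset Printing Implicit Defensive.

Import Order.TTheory GRing.Theory Num.Theory.
Import numFieldNormedType.Exports.

Local Open Scope classical_set_scope.
Local Open Scope ring_scope.

(* Nonempty metric spaces: measurable types are pointed in this library. The
   chosen point plays no role below, and the empty space has neither points nor
   accumulation points. *)
#[short(type="pmetricType")]
HB.structure Definition PointedMetric (R : numDomainType) :=
  {M of Metric R M & Pointed M}.

(* Only the values of [d] enter the notion of reach. It is allowed to be
   extended-real valued so that W_p needs no finiteness or metric axioms to be
   plugged in (see [wasserstein]). *)
Section reach.
Context {R : realType} {Y : Type} (d : Y -> Y -> \bar R).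

Definition dist_to (A : set Y) (y : Y) : \bar R :=
  ereal_inf [set d y a | a in A].

Definition Unp (A : set Y) : set Y :=
  [set y | exists! a, A a /\ dist_to A y = d y a].

Definition open_ball (a : Y) (r : R) : set Y := [set y | (d a y < r%:E)%E].

Definition reach_at (A : set Y) (a : Y) : \bar R :=
  ereal_sup [set r%:E | r in [set r : R | 0 <= r /\ open_ball a r `<=` Unp A]].

Definition reach (A : set Y) : \bar R :=
  ereal_inf [set reach_at A a | a in A].

End reach.

Notation borel T := (g_sigma_algebraType (@open T)).

Section wasserstein_space.
Context {R : realType} (X : pmetricType R).
Implicit Types (p : R) (mu nu : probability (borel X) R).

Definition finite_moment p mu :=
  exists x0 : X, (\int[mu]_x ((mdist (x : X) x0) `^ p)%:E < +oo)%E.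

(* Plans are Borel probability measures for the product topology: the
   product of the Borel sigma-algebras can be strictly smaller when X is not
   separable, and then the distance need not be measurable for it. *)
Definition transference_plan mu nu :
    set (probability (borel (X * X)%type) R) :=
  [set pi | (forall A : set (borel X), measurable A -> pi (fst @^-1` A) = mu A)
         /\ (forall A : set (borel X), measurable A -> pi (snd @^-1` A) = nu A)].

(* Defined for all p, but meaningful for p >= 1. The value is +oo when there is
   no plan of finite cost; there is always one when mu or nu is a Dirac mass
   and both have finite p-th moment. *)
Definition wasserstein p mu nu : \bar R :=
  ((ereal_inf [set (\int[pi]_z ((mdist (z.1 : X) z.2) `^ p)%:E)%E
              | pi in transference_plan mu nu]) `^ p^-1)%E.

(* Elements of [probability] are functions on all sets, measurable or not. Two
   of them that agree on Borel sets have the same plans, hence the same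
   W_p-distance to every point, so they cannot be told apart by [open_ball] or
   [Unp A]. *)
Definition Wspace p := {mu : probability (borel X) R | finite_moment p mu}.

Definition Wdist p (mu nu : Wspace p) : \bar R :=
  wasserstein p (sval mu) (sval nu).

Lemma measurable_mdist (x0 : X) :
  measurable_fun setT (fun x : borel X => mdist (x : X) x0).
Proof.
apply: (measurability _ (RGenInftyO.measurableE R)).
move=> _ [_ [r ->] <-]; rewrite setTI.
apply: sub_sigma_algebra; rewrite openE => y /=.
rewrite in_itv/= => yr.
rewrite /interior -filter_from_ballE; exists (r - mdist y x0).
  by rewrite /= subr_gt0.
move=> z; rewrite ballEmdist /= => yz; rewrite in_itv/=.
rewrite (le_lt_trans (metric_triangle z y x0))//.
by rewrite metric_sym -ltrBrDr.
Qed.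

Lemma finite_moment_dirac p (x : X) :
  finite_moment p (dirac (x : borel X) : probability (borel X) R).
Proof.
exists x; rewrite integral_dirac//; first by rewrite diracT mul1e ltry.
apply/measurable_EFinP; exact: (measurableT_comp (measurable_powR p) (measurable_mdist x)).
Qed.

Definition dirac_embed p (x : X) : Wspace p :=
  exist _ (dirac (x : borel X) : probability (borel X) R)
    (finite_moment_dirac p x).

End wasserstein_space.

Arguments Wdist {R X} p mu nu.
Arguments dirac_embed {R X} p x.

(* Main.v *)
(* For x <> y, the measure (δ_x + δ_y)/2 is at distance (d(x,z) + d(y,z))/2
   from δ_z, because δ_z leaves no choice of plan. By the triangle inequality
   the minimum d(x,y)/2 is attained at both z = x and z = y, so this measure has
   no unique nearest Dirac mass, while it is as close to δ_x as y is to x. *)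
Require Import Defs.
From HB Require Import structures.
From mathcomp Require Import all_boot all_order all_algebra.
From mathcomp Require Import all_classical all_reals all_analysis.
From mathcomp Require Import measurable_realfun lra.
Local Open Scope classical_set_scope.
Local Open Scope ring_scope.

Set Implicit Arguments.
Unset Strict Implicit.
Unset Printing Implicit Defensive.

Import Order.TTheory GRing.Theory Num.Theory.
Import numFieldNormedType.Exports.

(** Radius 0 always competes in the supremum, its open ball being empty. *)
Lemma reach_at_ge0 (R : realType) (Y : Type) (d : Y -> Y -> \bar R) (A : set Y) (a : Y) :
  (forall y, 0 <= d a y)%E -> (0 <= reach_at d A a)%E.
Proof.
move=> d0; apply: ereal_sup_ubound; exists 0 => //; split => // y.
by rewrite /open_ball/= ltNge d0.
Qed.

(** Preimages need only be checked on generators; with open sets as generators, continuity yields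
    Borel measurability. *)
Lemma g_sigma_algebra_measurable_fun (S T : pointedType) (F : set_system S)
    (G : set_system T) (f : S -> T) : (forall B, G B -> F (f @^-1` B)) ->
  measurable_fun setT (f : g_sigma_algebraType F -> g_sigma_algebraType G).
Proof.
move=> FG; apply: (@measurability _ _ _ (g_sigma_algebraType G) _ _ G erefl).
by move=> _ [B GB <-]; rewrite setTI; apply: sub_sigma_algebra; exact: FG.
Qed.

Lemma closed_borel_measurable (T : ptopologicalType) (A : set T) :
  closed A -> measurable (A : set (borel T)).
Proof.
move=> cA; rewrite -(setCK A); apply: measurableC.
by apply: sub_sigma_algebra; exact: closed_openC.
Qed.

(** * Borel measurability of the cost *)

Section metric_borel.
Context {R : realType} (X : pmetricType R).
Implicit Types (x y z : X) (p : R).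

Lemma measurable_mdist2 :
  measurable_fun setT (fun u : borel (X * X)%type => mdist (u.1 : X) u.2).
Proof.
apply: (measurability _ (RGenInftyO.measurableE R)).
move=> _ [_ [r ->] <-]; rewrite setTI.
apply: sub_sigma_algebra; rewrite openE => -[x y] /=.
rewrite in_itv/= => xyr.
(* Half of the slack for each coordinate: moving both by less than [e] keeps the distance below
   [r]. *)
pose e := (r - mdist x y) / 2.
have e0 : 0 < e by rewrite divr_gt0// subr_gt0.
exists (ball x e, ball y e); first by split; exact: nbhsx_ballx.
move=> [a b] [] /=; rewrite !ballEmdist/= in_itv/= /e => xa yb.
have h1 := metric_triangle a x b; have h2 := metric_triangle x y b.
rewrite (metric_sym a x) in h1.
lra.
Qed.

Lemma measurable_cost p : measurable_fun setT
  (fun u : borel (X * X)%type => ((mdist (u.1 : X) u.2) `^ p)%:E).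
Proof.
apply/measurable_EFinP.
exact: (measurableT_comp (measurable_powR p) measurable_mdist2).
Qed.

Lemma measurable_cost_to p z : measurable_fun setT
  (fun x : borel X => ((mdist (x : X) z) `^ p)%:E).
Proof.
apply/measurable_EFinP.
exact: (measurableT_comp (measurable_powR p) (measurable_mdist z)).
Qed.

End metric_borel.

(** * Transport to a Dirac mass *)

Section wasserstein_dirac.
Context {R : realType} (X : pmetricType R).
Implicit Types (x y z : X) (p : R) (mu nu : probability (borel X) R).

Lemma measurable_fst_borel : measurable_fun setT
  (fst : borel (X * X)%type -> borel X).
Proof.
apply: g_sigma_algebra_measurable_fun; apply/continuousP => u; exact: cvg_fst.
Qed.

Lemma measurable_snd_borel : measurable_fun setT
  (snd : borel (X * X)%type -> borel X).
Proof.
apply: g_sigma_algebra_measurable_fun; apply/continuousP => u; exact: cvg_snd.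
Qed.

Lemma measurable_swap_borel : measurable_fun setT
  (swap_pair : borel (X * X)%type -> borel (X * X)%type).
Proof.
apply: g_sigma_algebra_measurable_fun; apply/continuousP; exact: swap_continuous.
Qed.

Lemma measurable_pair_borel z : measurable_fun setT
  ((fun x => (x, z)) : borel X -> borel (X * X)%type).
Proof.
apply: g_sigma_algebra_measurable_fun; apply/continuousP => u.
by apply: cvg_pair => //; exact: cvg_cst.
Qed.

(** Pushing a plan forward along the swap exchanges its marginals and keeps its cost. *)
Lemma wasserstein_sym p mu nu : wasserstein p mu nu = wasserstein p nu mu.
Proof.
suff sub m n :
    [set (\int[pi]_z ((mdist (z.1 : X) z.2) `^ p)%:E)%E
      | pi in transference_plan m n] `<=`
    [set (\int[pi]_z ((mdist (z.1 : X) z.2) `^ p)%:E)%E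
      | pi in transference_plan n m].
  by rewrite /wasserstein; congr (ereal_inf _ `^ _)%E; apply/seteqP; split; exact: sub.
move=> _ [pi [pi1 pi2] <-].
pose s : {mfun borel (X * X)%type >-> borel (X * X)%type} :=
  HB.pack (swap_pair : borel (X * X)%type -> borel (X * X)%type)
  (isMeasurableFun.Build _ _ _ _ _ measurable_swap_borel).
exists (distribution pi s); first by split=> A mA; [exact: pi2|exact: pi1].
rewrite ge0_integral_distribution//=.
- by apply: eq_integral => u _ /=; rewrite metric_sym.
- exact: measurable_cost.
- by move=> u; rewrite lee_fin powR_ge0.
Qed.

(** The second marginal is concentrated at [z], so [u.2 = z] holds [pi]-almost everywhere and the
    cost depends on [u.1] alone, whose law is [mu]. *)
Lemma plan_dirac_cost p mu z pi : transference_plan mu (dirac (z : borel X)) pi ->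
  (\int[pi]_u ((mdist (u.1 : X) u.2) `^ p)%:E =
   \int[mu]_x ((mdist (x : X) z) `^ p)%:E)%E.
Proof.
move=> [pi1 pi2].
have mz : measurable (~` [set z] : set (borel X)).
  apply: measurableC; apply: closed_borel_measurable.
  exact/accessible_closed_set1/hausdorff_accessible/metric_hausdorff.
transitivity (\int[pi]_u ((mdist (u.1 : X) z) `^ p)%:E)%E.
  apply: ge0_ae_eq_integral => //.
  - exact: measurable_cost.
  - exact: (measurableT_comp (measurable_cost_to p z) measurable_fst_borel).
  - by move=> *; rewrite lee_fin powR_ge0.
  - by move=> *; rewrite lee_fin powR_ge0.
  (* This set contains every pair with [u.2] different from [z], and its mass is that of the
     complement of [z] under the Dirac mass, namely 0. *)
  exists (snd @^-1` (~` [set z])); split.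
  - rewrite -[X in measurable X]setTI; exact: measurable_snd_borel.
  - apply: etrans (pi2 _ mz) _.
    by rewrite /= diracE memNset//= => /(_ erefl).
  - by move=> u /= uz uz2; apply: uz => _; rewrite uz2.
pose f : {mfun borel (X * X)%type >-> borel X} :=
  HB.pack (fst : borel (X * X)%type -> borel X)
  (isMeasurableFun.Build _ _ _ _ _ measurable_fst_borel).
transitivity (\int[distribution pi f]_x ((mdist (x : X) z) `^ p)%:E)%E.
  rewrite ge0_integral_distribution//=; first exact: measurable_cost_to.
  by move=> u; rewrite lee_fin powR_ge0.
by apply: eq_measure_integral => A mA _; exact: pi1.
Qed.

(** All plans have the same cost, so the infimum is over a singleton once a plan exists: the image
    of [mu] under [x |-> (x, z)]. *)
Lemma wasserstein_dirac p mu z :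
  wasserstein p mu (dirac (z : borel X)) =
  ((\int[mu]_x ((mdist (x : X) z) `^ p)%:E) `^ p^-1)%E.
Proof.
rewrite /wasserstein (_ : [set _ | _ in _] =
    [set (\int[mu]_x ((mdist (x : X) z) `^ p)%:E)%E]) ?ereal_inf1//.
apply/seteqP; split=> [_ [pi plan_pi <-]|_ ->]; first exact: plan_dirac_cost.
pose f : {mfun borel X >-> borel (X * X)%type} :=
  HB.pack ((fun x => (x, z)) : borel X -> borel (X * X)%type)
  (isMeasurableFun.Build _ _ _ _ _ (measurable_pair_borel z)).
have plan_f : transference_plan mu (dirac (z : borel X)) (distribution mu f).
  split=> A mA; first by [].
  rewrite -[LHS]/(mu (cst z @^-1` A)) preimage_cst /= diracE.
  by case: (z \in A); [exact: probability_setT|exact: measure0].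
by exists (distribution mu f) => //; exact: plan_dirac_cost.
Qed.

(** * The measures halfway between two Dirac masses *)

Lemma measurable_half_choice x y : measurable_fun setT
  ((fun b => if b then x else y) : bool -> borel X).
Proof. by []. Qed.

Definition half_choice x y : {mfun bool >-> borel X} :=
  HB.pack ((fun b => if b then x else y) : bool -> borel X)
  (isMeasurableFun.Build _ _ _ _ _ (measurable_half_choice x y)).

(** The measure (δ_x + δ_y)/2, as the law of a fair coin choosing between [x] and [y]. *)
Definition half_dirac x y : probability (borel X) R :=
  distribution (bernoulli_prob (2^-1 : R)) (half_choice x y).

Lemma integral_half_dirac x y (f : borel X -> \bar R) :
  measurable_fun setT f -> (forall u, 0 <= f u)%E ->
  (\int[half_dirac x y]_u f u = 2^-1%:E * f x + 2^-1%:E * f y)%E.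
Proof.
move=> mf f0; rewrite ge0_integral_distribution// integral_bernoulli_prob//=.
  by congr (_ + _%:E * _)%E; rewrite -[LHS]/(1 - 2^-1); lra.
lra.
Qed.

Lemma wasserstein_half_dirac x y z :
  wasserstein 1 (half_dirac x y) (dirac (z : borel X)) =
  ((mdist x z + mdist y z) / 2)%:E.
Proof.
rewrite wasserstein_dirac integral_half_dirac//; last 2 first.
- exact: measurable_cost_to.
- by move=> u; rewrite lee_fin powR_ge0.
rewrite invr1 -!EFinM -EFinD !powRr1 ?mdist_ge0// poweRe1.
  by congr EFin; lra.
by rewrite lee_fin; have := mdist_ge0 x z; have := mdist_ge0 y z; lra.
Qed.

Lemma finite_moment_half_dirac p x y : finite_moment p (half_dirac x y).
Proof.
exists x; rewrite integral_half_dirac; last 2 first.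
- exact: measurable_cost_to.
- by move=> u; rewrite lee_fin powR_ge0.
by rewrite -!EFinM -EFinD ltry.
Qed.

Definition half_point x y : Wspace X 1 :=
  exist _ (half_dirac x y) (finite_moment_half_dirac 1 x y).

(** The value at [[set x]] separates the two masses. Uniqueness in [Unp] concerns points of
    [Wspace]; this brings it back to [X]. *)
Lemma dirac_embed_inj p : injective (@dirac_embed R X p).
Proof.
move=> x y /(congr1 (fun m : Wspace X p =>
  (sval m : set (borel X) -> \bar R) [set x])).
rewrite /= !diracE mem_set// => /esym; apply: contraPP => xy.
rewrite memNset; last by move=> yx; exact: xy.
by case=> /esym/eqP; rewrite oner_eq0.
Qed.

Lemma half_point_notin_Unp x y : x != y ->
  ~ Unp (Wdist 1) (range (@dirac_embed R X 1)) (half_point x y).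
Proof.
move=> /eqP xy [a [_ uniq_a]].
have distE : dist_to (Wdist 1) (range (@dirac_embed R X 1)) (half_point x y)
             = (mdist x y / 2)%:E.
  apply/eqP; rewrite eq_le; apply/andP; split.
    apply: ereal_inf_lbound; exists (dirac_embed 1 x); first by exists x.
    by rewrite /Wdist/= wasserstein_half_dirac mdistxx add0r metric_sym.
  apply: le_ereal_inf_tmp => _ [_ [z _ <-] <-].
  rewrite /Wdist/= wasserstein_half_dirac lee_fin ler_pM2r//.
  by rewrite (metric_sym y z) metric_triangle.
(* Both endpoint masses attain the distance, so uniqueness identifies each with [a], forcing
   [x = y]. *)
apply: xy; apply: (@dirac_embed_inj 1).
rewrite -(uniq_a (dirac_embed 1 x)).
  apply: uniq_a; split; first by exists y.
  by rewrite distE /Wdist/= wasserstein_half_dirac mdistxx addr0.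
split; first by exists x.
by rewrite distE /Wdist/= wasserstein_half_dirac mdistxx add0r metric_sym.
Qed.

Lemma wasserstein_ge0 p mu nu : (0 <= wasserstein p mu nu)%E.
Proof. exact: poweR_ge0. Qed.

(** Every positive radius [r] fails: some [y] other than [x] lies within [r] of [x], and
    [half_point x y], at distance [mdist x y / 2] from δ_x, is in the ball but not in [Unp]. *)
Lemma reach_at_limit_point x : limit_point [set: X] x ->
  reach_at (Wdist 1) (range (@dirac_embed R X 1)) (dirac_embed 1 x) = 0%E.
Proof.
move=> lx; apply/eqP; rewrite eq_le; apply/andP; split; last first.
  by apply: reach_at_ge0 => y; exact: wasserstein_ge0.
apply: ge_ereal_sup => _ [r [r0 ballU] <-]; rewrite lee_fin leNgt.
apply/negP => {}r0.
have [y [yx _ xyr]] := lx _ (nbhsx_ballx x r r0).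
apply: (@half_point_notin_Unp x y); first by rewrite eq_sym.
apply: ballU; rewrite /open_ball/= /Wdist/= wasserstein_sym.
rewrite wasserstein_half_dirac mdistxx add0r lte_fin metric_sym.
move: xyr; rewrite ballEmdist/=; have := mdist_ge0 x y; lra.
Qed.

End wasserstein_dirac.

Theorem theorem4p3 (R : realType) (X : pmetricType R) :
  (forall x : X, limit_point [set: X] x ->
     reach_at (Wdist 1) (range (@dirac_embed R X 1)) (dirac_embed 1 x) = 0%E) /\
  (limit_point [set: X] !=set0 ->
     reach (Wdist 1) (range (@dirac_embed R X 1)) = 0%E).
Proof.
split=> [x|[x lx]]; first exact: reach_at_limit_point.
(* The infimum is at most its term at the accumulation point, which is 0, and no term is
   negative. *)
apply/eqP; rewrite eq_le; apply/andP; split.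
  rewrite -(reach_at_limit_point lx); apply: ereal_inf_lbound.
  by exists (dirac_embed 1 x) => //; exists x.
apply: le_ereal_inf_tmp => _ [a _ <-].
by apply: reach_at_ge0 => y; exact: wasserstein_ge0.
Qed.
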